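(* There exists a Mazurkiewicz set $M\subseteq\mathbb{R}^2$ such that for every rotation $\rho$ of $\mathbb{R}^2$ about the origin, the set $\rho[M]$ contains the graph of a Sierpiński-Zygmund function $f\colon\mathbb{R}\to\mathbb{R}$.
   Context: Work in ZFC; $\mathfrak{c}$ denotes the cardinality of $\mathbb{R}$. Functions and partial functions from $\mathbb{R}$ into $\mathbb{R}$ are identified with their graphs (subsets of $\mathbb{R}^2$). A Mazurkiewicz set is a set $M\subseteq\mathbb{R}^2$ that intersects every straight line of $\mathbb{R}^2$ in exactly two points. A set $X\subseteq\mathbb{R}^2$ is a Sierpiński-Zygmund set if $|X\cap f|<\mathfrak{c}$ for every continuous partial function $f$ from $\mathbb{R}$ into $\mathbb{R}$ (i.e. continuous function defined on some subset of $\mathbb{R}$). A Sierpiński-Zygmund function is a (total) function $f\colon\mathbb{R}\to\mathbb{R}$ whose graph is a Sierpiński-Zygmund set. *)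

(* Defs.v *)
From mathcomp Require Import all_boot all_order all_algebra.
From mathcomp Require Import all_classical all_reals all_analysis.

Set Implicit Arguments.
Unset Strict Implicit.
Unset Printing Implicit Defensive.

Import Order.TTheory GRing.Theory Num.Theory.
Import numFieldNormedType.Exports.

Local Open Scope classical_set_scope.
Local Open Scope ring_scope.
Local Open Scope card_scope.

Definition card_lt (T U : Type) (A : set T) (B : set U) : Prop :=
  A #<= B /\ A #!= B.

Section Plane.
Variable R : realType.

Definition straight_line (L : set (R * R)) : Prop :=
  exists a b c : R, (a, b) != (0, 0) /\
    L = [set p | a * p.1 + b * p.2 = c].

Definition Mazurkiewicz_set (M : set (R * R)) : Prop :=
  forall L : set (R * R), straight_line L -> M `&` L #= `I_2.

(* The graph of the partial function with domain D that agrees with f on D. *)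
Definition pgraph (D : set R) (f : R -> R) : set (R * R) :=
  [set p | D p.1 /\ p.2 = f p.1].

(* [{within D, continuous f}] is continuity for the subspace topology of D,
   so the values of f outside D play no role. *)
Definition continuous_partial_function (F : set (R * R)) : Prop :=
  exists (D : set R) (f : R -> R),
    {within D, continuous f} /\ F = pgraph D f.

Definition SZ_set (X : set (R * R)) : Prop :=
  forall F : set (R * R), continuous_partial_function F ->
    card_lt (X `&` F) [set: R].

Definition SZ_function (f : R -> R) : Prop := SZ_set (pgraph setT f).

Definition rotation (theta : R) (p : R * R) : R * R :=
  (cos theta * p.1 - sin theta * p.2, sin theta * p.1 + cos theta * p.2).

End Plane.

(* Main.v *)
Require Import Defs.
From mathcomp Require Import all_boot all_order all_algebra.
From mathcomp Require Import all_classical all_reals all_analysis.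
From mathcomp Require wochoice.
From mathcomp Require Import ring lra.

(** Well-order [R] so that every proper initial segment has fewer than
    continuum many elements, and enumerate along this order all lines (each at
    least twice) and all tasks [(d, S)], where [d] is a direction and [S] codes
    a continuous partial function. Stage [a] ensures one more point on the line
    [L_a], if it does not have two already. A new point is chosen on [L_a]
    - off every line through two earlier points,
    - for every earlier task of direction parallel to [L_a], off the graph of
      the task in the coordinates given by its direction,
    - for every earlier task of direction [d] not parallel to [L_a], off every
      line of direction [d] through an earlier point.
    Each requirement excludes at most one point of [L_a] for each pair of
    earlier stages, so fewer than continuum many points in all.
    Given a rotation, [f] picks on each vertical line the point of the rotated
    set that was added later. If this happened after the stage of a task with
    the same direction, the third requirement shows that the point was added
    for the sake of that very line, and the second one that it avoids the
    graph of the task. *)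

Set Implicit Arguments.
Unset Strict Implicit.
Unset Printing Implicit Defensive.

Import Order.TTheory GRing.Theory Num.Theory.
Import numFieldNormedType.Exports.

Local Open Scope classical_set_scope.
Local Open Scope ring_scope.
Local Open Scope card_scope.

(** * Products of infinite sets *)

Definition inj_into (T U : Type) (A : set T) (B : set U) (f : T -> U) :=
  (forall x, A x -> B (f x)) /\
  (forall x y, A x -> A y -> f x = f y -> x = y).

Lemma inj_into_left_inverse (T : pointedType) (U : Type) (A : set T)
    (B : set U) (f : T -> U) :
  inj_into A B f -> exists g : U -> T, forall x, A x -> g (f x) = x.
Proof.
move=> [_ finj]; exists (fun u => xget point [set x | A x /\ f x = u]) => x Ax.
by case: xgetP => [y -> [Ay /finj]|/(_ x)[]//]; exact.
Qed.

Lemma chain_bigcup2 (T : Type) (F : set (set T)) (z w : T) :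
  total_on F subset -> (\bigcup_(X in F) X) z -> (\bigcup_(X in F) X) w ->
  exists2 X, F X & X z /\ X w.
Proof.
move=> Ftot [X FX Xz] [Y FY Yw].
by case: (Ftot _ _ FX FY) => [XY|YX]; [exists Y|exists X] => //; split => //;
  [apply: XY|apply: YX].
Qed.

(** Comparability of cardinals by Zorn's lemma: a maximal partial injection [G] exhausts [A] or [B],
    since otherwise a pair of unmatched points could be added. *)
Lemma inj_into_total (T U : pointedType) (A : set T) (B : set U) :
  (exists f, inj_into A B f) \/ (exists g, inj_into B A g).
Proof.
pose P (G : set (T * U)) := [/\ forall z, G z -> A z.1 /\ B z.2,
  forall x y y', G (x, y) -> G (x, y') -> y = y' &
  forall x x' y, G (x, y) -> G (x', y) -> x = x'].
have [F FP Ftot|G [[GAB Gfun Ginj] Gmax]] := @Zorn_bigcup _ P.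
  split.
  - by move=> z [X /FP[XAB _ _] /XAB].
  - move=> x y y' Uy Uy'.
    have [X /FP[_ Xfun _] [Xy Xy']] := chain_bigcup2 Ftot Uy Uy'.
    exact: Xfun Xy Xy'.
  - move=> x x' y Ux Ux'.
    have [X /FP[_ _ Xinj] [Xx Xx']] := chain_bigcup2 Ftot Ux Ux'.
    exact: Xinj Xx Xx'.
have [[a [Aa Ga]]|NA] := pselect (exists a, A a /\ forall y, ~ G (a, y)); last first.
  left; have ex x : exists y, A x -> G (x, y).
    have [Ax|] := pselect (A x); last by exists point.
    have [[y Gy]|Ny] := pselect (exists y, G (x, y)); first by exists y.
    by exfalso; apply: NA; exists x; split => // y Gy; apply: Ny; exists y.
  have [f fP] := choice ex; exists f; split=> [x /fP/GAB[]//|x y /fP Gx /fP Gy fxy].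
  by apply: (Ginj _ _ _ Gx); rewrite fxy.
have [[b [Bb Gb]]|NB] := pselect (exists b, B b /\ forall x, ~ G (x, b)); last first.
  right; have ex y : exists x, B y -> G (x, y).
    have [By|] := pselect (B y); last by exists point.
    have [[x Gx]|Nx] := pselect (exists x, G (x, y)); first by exists x.
    by exfalso; apply: NB; exists y; split => // x Gx; apply: Nx; exists x.
  have [f fP] := choice ex; exists f; split=> [x /fP/GAB[]//|x y /fP Gx /fP Gy fxy].
  by apply: (Gfun _ _ _ Gx); rewrite fxy.
exfalso; apply: (Gmax (G `|` [set (a, b)])).
  split; first by move=> z Gz; left.
  by move=> /(_ (a, b)) h; apply: (Ga b); apply: h; right.
split.
- by move=> z [/GAB//|->].
- move=> x y y' [Gy|[xa ->]] [Gy'|[xa' ->]] //; first exact: Gfun Gy Gy'.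
  + by case: (Ga y); rewrite -xa'.
  + by case: (Ga y'); rewrite -xa.
- move=> x x' y [Gx|[-> yb]] [Gx'|[-> yb']] //; first exact: Ginj Gx Gx'.
  + by case: (Gb x); rewrite -yb'.
  + by case: (Gb x'); rewrite -yb.
Qed.

Section Hessenberg.
Variables (T : pointedType) (A : set T) (iota : nat -> T).
Hypothesis iotaA : forall n, A (iota n).
Hypothesis iota_inj : injective iota.

(** The graphs of interest are injections of [X * X] into [X]; reading [X] off the diagonal lets [G]
    alone carry the data for Zorn's lemma. *)
Let dom (G : set ((T * T) * T)) : set T := [set x | exists y, G ((x, x), y)].

Let square_graph (G : set ((T * T) * T)) :=
  [/\ forall x x' y, G ((x, x'), y) -> [/\ dom G x, dom G x' & dom G y],
      forall x x', dom G x -> dom G x' -> exists y, G ((x, x'), y),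
      forall p y y', G (p, y) -> G (p, y') -> y = y',
      forall p p' y, G (p, y) -> G (p', y) -> p = p' &
      dom G `<=` A].

(** The pairing of the naturals carried over by [iota]. Graphs above it have [iota 0] and [iota 1]
    in their domain, which serve as tags in [doubling]. *)
Let G0 : set ((T * T) * T) :=
  [set z | exists m n, z = ((iota m, iota n), iota (pickle (m, n)))].

Let dom_G0 n : dom G0 (iota n).
Proof. by exists (iota (pickle (n, n))), n, n. Qed.

Let square_graph_G0 : square_graph G0.
Proof.
split.
- by move=> x x' y [m [n [-> -> ->]]]; split; exact: dom_G0.
- move=> x x' [_ [m [_ [-> _ _]]]] [_ [n [_ [-> _ _]]]].
  by exists (iota (pickle (m, n))), m, n.
- move=> _ _ _ [m [n [-> ->]]] [m' [n' [/iota_inj-> /iota_inj-> ->]]] //.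
- move=> _ _ _ [m [n [-> ->]]] [m' [n' [-> /iota_inj e]]].
  by have [-> ->] := pcan_inj pickleK e.
- by move=> _ [_ [m [_ [-> _ _]]]].
Qed.

Let maximal_square_graph : exists G, [/\ square_graph G, G0 `<=` G &
  forall G', G `<` G' -> ~ square_graph G'].
Proof.
pose P G := G = set0 \/ (G0 `<=` G /\ square_graph G).
have [F FP Ftot|G [PG Gmax]] := @Zorn_bigcup _ P.
  have [[z Uz]|N] := pselect (exists z, (\bigcup_(X in F) X) z); last first.
    by left; apply/seteqP; split => // z Uz; apply: N; exists z.
  right.
  have FX X z' : F X -> X z' -> G0 `<=` X /\ square_graph X.
    by move=> /FP[->|].
  have domU X : F X -> dom X `<=` dom (\bigcup_(X in F) X).
    by move=> FX' x [y Xy]; exists y, X.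
  split; first by case: Uz => X FX' Xz w /(FX _ _ FX' Xz).1 ?; exists X.
  split.
  - move=> x x' y [X FX' Xz]; have [_ [h _ _ _ _]] := FX _ _ FX' Xz.
    by have [? ? ?] := h _ _ _ Xz; split; apply: domU FX' _ _.
  - move=> x x' [y Uy] [y' Uy'].
    have [X FX' [Xy Xy']] := chain_bigcup2 Ftot Uy Uy'.
    have [_ [_ h _ _ _]] := FX _ _ FX' Xy.
    have [||w Xw] := h x x'; [by exists y|by exists y'|].
    by exists w, X.
  - move=> p y y' Uy Uy'; have [X FX' [Xy Xy']] := chain_bigcup2 Ftot Uy Uy'.
    have [_ [_ _ h _ _]] := FX _ _ FX' Xy; exact: h Xy Xy'.
  - move=> p p' y Uy Uy'; have [X FX' [Xy Xy']] := chain_bigcup2 Ftot Uy Uy'.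
    have [_ [_ _ _ h _]] := FX _ _ FX' Xy; exact: h Xy Xy'.
  - move=> x [y [X FX' Xy]]; have [_ [_ _ _ _ h]] := FX _ _ FX' Xy.
    by apply: h; exists y.
case: PG => [G_0|[G0G sG]].
  exfalso; apply: (Gmax G0); last by right; split.
  rewrite G_0; split=> // h.
  by have := h ((iota 0, iota 0), iota (pickle (0, 0)%N)); apply; exists 0%N, 0%N.
exists G; split => // G' GG' sG'; apply: (Gmax _ GG'); right; split => //.
by apply: subset_trans GG'.1.
Qed.

(** The maps [h (_, iota 0)] and [h (_, iota 1)] have disjoint ranges on [X]: the first receives
    [X], the second receives the rest of [Y] by way of [j]. *)
Let doubling (X Y : set T) (h : T * T -> T) (j : T -> T) :
  inj_into (X `*` X) X h -> inj_into Y X j -> X (iota 0) -> X (iota 1) ->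
  exists k, inj_into (X `|` Y) X k.
Proof.
move=> [hX hinj] [jX jinj] X0 X1.
exists (fun a => if pselect (X a) then h (a, iota 0) else h (j a, iota 1)).
have N01 : iota 0 <> iota 1 by move=> /iota_inj.
split=> [x XYx|x y XYx XYy].
  by case: pselect => Xx; apply: hX; split => //=; apply: jX; case: XYx.
case: pselect => Xx; case: pselect => Xy /hinj h_.
- by have [] : (x, iota 0) = (y, iota 0) by apply: h_; split.
- have [_ //] : (x, iota 0) = (j y, iota 1).
    by apply: h_; split => //=; apply: jX; case: XYy.
- have [_ /esym//] : (j x, iota 1) = (y, iota 0).
    by apply: h_; split => //=; apply: jX; case: XYx.
- have Yx : Y x by case: XYx.
  have Yy : Y y by case: XYy.
  have [/jinj] : (j x, iota 1) = (j y, iota 1).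
    by apply: h_; split => //=; exact: jX.
  exact.
Qed.

(** Let [X] be the domain of a maximal graph. If the rest of [A] injects into [X], doubling injects
    [A] into [X], and [h] does the rest. Otherwise [X] has a copy in the rest of [A], which leaves
    room to extend the graph. *)
Lemma inj_into_square : exists h, inj_into (A `*` A) A h.
Proof.
have [G [sG G0G Gmax]] := maximal_square_graph.
have [Gdom Gtot Gfun Ginj domA] := sG.
set X := dom G in Gdom Gtot domA.
have Xi n : X (iota n) by have [y /G0G] := dom_G0 n; exists y.
have ex p : exists y, X p.1 -> X p.2 -> G (p, y).
  case: p => a b /=; have [Xa|] := pselect (X a); last by exists point.
  have [Xb|] := pselect (X b); last by exists point.
  by have [y] := Gtot _ _ Xa Xb; exists y.
have [h hP] := choice ex.
have hinj : inj_into (X `*` X) X h.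
  split=> [[a b] [/= Xa Xb]|p q [pa pb] [qa qb] e].
    by have := hP (a, b) Xa Xb => /Gdom[].
  by have := hP p pa pb; rewrite e => hp; exact: Ginj hp (hP q qa qb).
have [[j jinj]|[j jinj]] := inj_into_total (A `\` X) X.
  have [k [kX kinj]] := doubling hinj jinj (Xi 0%N) (Xi 1%N).
  have AX : forall a, A a -> (X `|` (A `\` X)) a.
    by move=> a Aa; have [|] := pselect (X a); [left|right].
  exists (fun p => h (k p.1, k p.2)); split=> [[a b] [/= Aa Ab]|].
    by apply: domA; apply: hinj.1; split; apply/kX/AX.
  move=> [a b] [a' b'] [/= Aa Ab] [/= Aa' Ab'] /hinj.2 e.
  have [ea eb] : (k a, k b) = (k a', k b') by apply: e; split; apply/kX/AX.
  by congr pair; apply: kinj => //; exact: AX.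
(* A copy of [X] outside [X] would allow [G] to be extended. *)
have [i iK] := inj_into_left_inverse jinj.
have [jY jinj'] := jinj.
have iinj : inj_into (j @` X) X i.
  split=> [_ [x Xx <-]|_ _ [x Xx <-] [y Xy <-]]; first by rewrite iK.
  by rewrite !iK// => ->.
have [k [kX kinj]] := doubling hinj iinj (Xi 0%N) (Xi 1%N).
pose Z := X `|` j @` X.
(* New pairs take their values in the copy of [X] under [j], which is disjoint from [X], so they
   never clash with values of [G]. *)
pose h' (p : T * T) := j (h (k p.1, k p.2)).
have h'X p : Z p.1 -> Z p.2 -> (j @` X) (h' p).
  by move=> Z1 Z2; exists (h (k p.1, k p.2)) => //; apply: hinj.1; split; exact: kX.
have h'inj p q : Z p.1 -> Z p.2 -> Z q.1 -> Z q.2 -> h' p = h' q -> p = q.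
  case: p q => [a b] [a' b'] /= Za Zb Za' Zb' /jinj' e.
  have [ea eb] : (k a, k b) = (k a', k b').
    by apply: hinj.2; [split; exact: kX ..|];
      apply: e; apply: hinj.1; split; exact: kX.
  by congr pair; exact: kinj.
pose G' := G `|` [set z | [/\ Z z.1.1, Z z.1.2, ~ (X z.1.1 /\ X z.1.2) & z.2 = h' z.1]].
have XNj x : X x -> ~ (j @` X) x by move=> Xx [y Xy] e; have [_] := jY _ Xy; rewrite e.
have domG' x : dom G' x <-> Z x.
  split=> [[y [/Gdom[Xx _ _]|[]//]]|Zx]; first by left.
  have [Xx|NX] := pselect (X x).
    by have [y Gy] := Gtot _ _ Xx Xx; exists y; left.
  by exists (h' (x, x)); right; split => // -[].
exfalso; apply: (Gmax G').
  split; first by move=> z; left.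
  move=> /(_ ((j (iota 0), j (iota 0)), h' (j (iota 0), j (iota 0)))) h_.
  have Zj : Z (j (iota 0)) by right; exists (iota 0).
  have NX : ~ X (j (iota 0)) by have [] := jY _ (Xi 0%N).
  by case: (Gdom (j (iota 0)) (j (iota 0)) _ (h_ _)) => //; right; split => // -[].
split.
- move=> x x' y [/Gdom[? ? ?]|/=[Zx Zx' _ ->]]; split; apply/domG' => //; try by left.
  by right; exact: h'X.
- move=> x x' /domG' Zx /domG' Zx'.
  have [[Xx Xx']|N] := pselect (X x /\ X x').
    by have [y] := Gtot _ _ Xx Xx'; exists y; left.
  by exists (h' (x, x')); right; split.
- move=> [a b] y y' [Gy|[/= Za Zb N ->]] [Gy'|[/= _ _ N' ->]] //.
  + exact: Gfun Gy Gy'.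
  + by case: N'; have [] := Gdom _ _ _ Gy.
  + by case: N; have [] := Gdom _ _ _ Gy'.
- move=> [a b] [a' b'] y [Gy|[/= Za Zb N ->]] [Gy'|[/= Za' Zb' N' e]] //.
  + exact: Ginj Gy Gy'.
  + have [_ _ Xy] := Gdom _ _ _ Gy; case: (XNj _ Xy); rewrite e; exact: h'X.
  + have [_ _ Xy] := Gdom _ _ _ Gy'; case: (XNj _ Xy); exact: h'X.
  + exact: h'inj.
- by move=> x /domG'[/domA//|[y Xy <-]]; have [] := jY _ Xy.
Qed.

End Hessenberg.

(** * Sets of cardinality less than the continuum *)

Section Continuum.
Variable R : realType.

(** Sets of naturals become reals with digits 0 and 1 in base 4. The tail bound [2 * q ^+ k.+1] is
    half of [q ^+ k], so the first differing digit decides. *)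
Let q : R := 4^-1.

Let psum (S : set nat) (n : nat) : R :=
  \sum_(i < n) (if `[< S i >] then q ^+ i else 0).

Let q_gt0 n : 0 < q ^+ n. Proof. by rewrite exprn_gt0// invr_gt0. Qed.

Let psumS S n : psum S n.+1 = psum S n + (if `[< S n >] then q ^+ n else 0).
Proof. by rewrite /psum big_ord_recr. Qed.

Let psum_le S m n : (m <= n)%N -> psum S m <= psum S n.
Proof.
move=> /subnK <-; elim: (n - m)%N => //= k IH.
by rewrite addSn psumS (le_trans IH)// lerDl; case: ifP => // _; exact: ltW.
Qed.

(** These upper bounds decrease with the index because [q ^+ n + 2 * q ^+ n.+1 <= 2 * q ^+ n]. *)
Let psum_ge S m n : (m <= n)%N ->
  psum S n + 2 * q ^+ n <= psum S m + 2 * q ^+ m.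
Proof.
move=> /subnK <-; elim: (n - m)%N => //= k IH.
rewrite addSn psumS exprS (le_trans _ IH)//.
have := q_gt0 (k + m); rewrite /q; set x := (4^-1) ^+ _ => x0.
by case: ifP => _; lra.
Qed.

Let code (S : set nat) : R := sup (range (psum S)).

Let code_ge S n : psum S n <= code S.
Proof.
apply: ub_le_sup; last by exists n.
exists (psum S 0 + 2 * q ^+ 0) => _ [m _ <-].
by apply: le_trans (psum_ge _ (leq0n m)); rewrite lerDl mulr_ge0// ltW.
Qed.

Let code_le S n : code S <= psum S n + 2 * q ^+ n.
Proof.
apply: ge_sup; first by exists (psum S 0), 0%N.
move=> _ [m _ <-]; have [mn|/ltnW nm] := leqP m n.
  by apply: le_trans (psum_le _ mn) _; rewrite lerDl mulr_ge0// ltW.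
by apply: le_trans (psum_ge _ nm); rewrite lerDl mulr_ge0// ltW.
Qed.

Let code_inj : injective code.
Proof.
move=> S T eST; apply: contrapT => NST.
have ex : exists n, `[< S n >] != `[< T n >].
  apply: contrapT => N; apply: NST; apply/seteqP; split=> n; move: N;
  move=> /forallNP/(_ n)/negP; rewrite negbK => /eqP e /asboolP;
  by [rewrite e => /asboolP|rewrite -e => /asboolP].
case: (ex_minnP ex) => k Nk kmin.
have e : psum S k = psum T k.
  apply: eq_bigr => i _; case: eqVneq (kmin i) => [->//|_ /(_ isT)].
  by rewrite leqNgt ltn_ord.
(* By symmetry [k] lies in [S] only; this adds [q ^+ k], more than the later digits of [T] can
   supply. *)
wlog [Sk Tk] : S T eST {NST ex} kmin Nk e / `[< S k >] /\ ~~ `[< T k >].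
  move=> W; case: (boolP `[< S k >]) => Sk; case: (boolP `[< T k >]) => Tk.
  - by move: Nk; rewrite Sk Tk.
  - exact: (W S T).
  - by apply: (W T S) => // [n|]; rewrite eq_sym//; exact: kmin.
  - by move: Nk; rewrite (negPf Sk) (negPf Tk).
have := code_ge S k.+1; have := code_le T k.+1.
rewrite eST !psumS Sk (negPf Tk) e exprS.
by have := q_gt0 k; rewrite /q; set x := (4^-1) ^+ _ => x0; lra.
Qed.

Lemma surj_set_nat : exists e : R -> set nat, forall S, exists r, e r = S.
Proof.
exists (fun r => xget set0 [set S | code S = r]) => S; exists (code S).
by case: xgetP => [T _ /code_inj//|/(_ S)[]].
Qed.

Lemma surj_set_count (K : countType) :
  exists e : R -> set K, forall S, exists r, e r = S.
Proof.
have [e eS] := surj_set_nat.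
exists (fun r => [set k | e r (pickle k)]) => S.
have [r er] := eS [set n | exists2 k, S k & pickle k = n]; exists r.
apply/seteqP; split => k /=; rewrite er.
  by move=> [k' Sk' /(pcan_inj pickleK) <-].
by move=> Sk; exists k.
Qed.

Let real_of_cut (S : set nat) : R := sup [set ratr x | x in [set x | S (pickle x)]].

Let real_of_cut_surj r : exists S, real_of_cut S = r.
Proof.
exists [set n | exists2 x : rat, ratr x < r & pickle x = n].
rewrite /real_of_cut; set E := [set _ | _ in _].
have EP y : E y <-> exists2 x : rat, ratr x < r & ratr x = y.
  split=> [[x [x' x'r /(pcan_inj pickleK) <-] <-]|[x xr <-]]; first by exists x'.
  by exists x => //; exists x.
apply/eqP; rewrite eq_le; apply/andP; split.
  apply: ge_sup => [|_ /EP[x xr <-]]; last exact: ltW.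
  have [x] : exists x : rat, ratr x \in `]r - 1, r[%R by apply: rat_in_itvoo; lra.
  by rewrite in_itv /= => /andP[_ xr]; exists (ratr x); apply/EP; exists x.
rewrite leNgt; apply/negP => /rat_in_itvoo[x]; rewrite in_itv /= => /andP[Ex xr].
move: Ex; rewrite ltNge => /negP; apply; apply: ub_le_sup; last by apply/EP; exists x.
by exists r => _ /EP[y yr <-]; exact: ltW.
Qed.

(** The even and the odd members of one set of naturals code the cuts of the two coordinates. *)
Lemma surj_prod : exists e : R -> R * R, forall p, exists r, e r = p.
Proof.
have [e eS] := surj_set_nat.
exists (fun r => (real_of_cut [set n | e r n.*2],
                  real_of_cut [set n | e r n.*2.+1])) => -[x y].
have [S Sx] := real_of_cut_surj x; have [T Ty] := real_of_cut_surj y.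
have [r er] := eS [set n | if odd n then T n./2 else S n./2].
exists r; rewrite er /= -[in RHS]Sx -[in RHS]Ty.
congr (real_of_cut _, real_of_cut _); apply/seteqP; split=> n /=;
  by rewrite ?odd_double ?doubleK ?uphalf_double.
Qed.

(* Stated as the absence of surjections onto [R], which spares any choice of
   injections below. *)
Definition small (T : Type) (A : set T) :=
  forall g : T -> R, exists r, forall a, A a -> g a <> r.

Lemma small_sub (T : Type) (A B : set T) : A `<=` B -> small B -> small A.
Proof. by move=> AB sB g; have [r h] := sB g; exists r => a /AB/h. Qed.

Lemma small_image (T U : Type) (f : T -> U) (A : set T) :
  small A -> small (f @` A).
Proof. by move=> sA g; have [r h] := sA (g \o f); exists r => _ [a /h ? <-]. Qed.

(** Choice turns [K] into a function, with default [u0], whose image of [A] contains the set. This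
    bounds the points excluded by a requirement through the pairs of earlier stages. *)
Lemma small_functional (T U : Type) (u0 : U) (A : set T) (K : T -> U -> Prop) :
  small A -> (forall a u v, A a -> K a u -> K a v -> u = v) ->
  small [set u | exists2 a, A a & K a u].
Proof.
move=> sA Kfun; have ex a : exists u, A a -> forall v, K a v -> v = u.
  have [Aa|] := pselect (A a); last by exists u0.
  have [[u Ku]|N] := pselect (exists u, K a u).
    by exists u => _ v Kv; exact: Kfun Aa Kv Ku.
  by exists u0 => _ v Kv; case: N; exists v.
have [f fP] := choice ex; apply: small_sub (small_image f sA).
by move=> u [a Aa Ku]; exists a => //; rewrite -(fP a Aa _ Ku).
Qed.

Lemma small_setU (T : Type) (A B : set T) :
  small A -> small B -> small (A `|` B).
Proof.
(* Koenig's argument: [A] misses a column of [R * R] and [B] misses a row. *)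
have [e eS] := surj_prod => sA sB g.
have [x hx] := sA (fun a => (e (g a)).1).
have [y hy] := sB (fun a => (e (g a)).2).
have [r er] := eS (x, y); exists r => a [/hx|/hy] + gr; by rewrite gr er.
Qed.

Lemma finite_small (T : Type) (A : set T) : finite_set A -> small A.
Proof.
move=> finA g; apply: contrapT => N.
have : finite_set [set: R].
  apply: sub_finite_set (finite_image g finA) => r _.
  apply: contrapT => Nr; apply: N; exists r => a Aa gr; apply: Nr.
  by exists a.
apply/infiniteP/pcard_leP/injfunPex; exists (fun n => n%:R) => // m n _ _.
by move=> /eqP; rewrite eqr_nat => /eqP.
Qed.

(** For infinite [A], a left inverse of an injection of the square into [A] exhibits the square
    inside an image of [A]. *)
Lemma small_square (T : pointedType) (A : set T) :
  small A -> small (A `*` A).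
Proof.
move=> sA; have [finA|/infiniteP/pcard_leP/injfunPex[i iA iinj]] :=
  pselect (finite_set A); first by apply: finite_small; exact: finite_setX.
have [h hinj] : exists h, inj_into (A `*` A) A h.
  apply: (@inj_into_square _ _ i) => [n|m n e]; first exact: iA.
  by apply: iinj => //; rewrite in_setE.
have [k hk] := inj_into_left_inverse hinj.
apply: small_sub (small_image k sA) => p Ap; exists (h p); last exact: hk.
exact: hinj.1.
Qed.

Lemma small_card_lt (X : set (R * R)) : small X -> card_lt X [set: R].
Proof.
have [e eS] := surj_prod => sX; split.
  have /card_le_trans : X #<= [set: R * R] by exact: card_leT.
  by apply; apply/pcard_surjP; exists e => p _; have [r er] := eS p; exists r.
apply/negP => /card_set_bijP[f [_ _ fsurj]].
have [r h] := sX f; have [p Xp] := fsurj r I; exact: h.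
Qed.

(** This order stands in for the initial ordinal of the continuum as the index set of the
    recursion. *)
Lemma well_order_small_segments : exists lt : R -> R -> Prop,
  [/\ well_founded lt,
      forall x y z, lt x y -> lt y z -> lt x z,
      forall x y, [\/ lt x y, x = y | lt y x] &
      forall x, small [set y | lt y x]].
Proof.
have [W Wwo] := wochoice.well_ordering_principle R.
have Wwo' : wochoice.wo_chain W predT by move=> A _; exact: Wwo.
have Wanti : antisymmetric W.
  by move=> x y; exact: (wochoice.wo_chain_antisymmetric Wwo').
have Wtot x y : W x y || W y x by exact: (wochoice.wo_chainW Wwo').
have Wmin (P : set R) : P !=set0 -> exists2 z, P z & forall x, P x -> W z x.
  move=> [x Px]; have [|z [[zP zmin] _]] := Wwo (fun x => `[< P x >]).
    by exists x; apply/asboolP.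
  by exists z; [apply/asboolP|move=> y Py; apply: zmin; apply/asboolP].
pose lt x y := W x y /\ x <> y.
have Nlt x y : W x y -> ~ lt y x by move=> xy [yx]; case; apply: Wanti; rewrite yx.
have lt_trans x y z : lt x y -> lt y z -> lt x z.
  move=> xy yz; have [|m mP mmin] := Wmin [set x; y; z]; first by exists x; left; left.
  move: mP => [[/= mx|/= my]|/= mz].
  - split; first by rewrite -mx; apply: mmin; right.
    by move=> xz; apply: (Nlt x y) => //; [case: xy|rewrite xz].
  - by exfalso; apply: (Nlt y x) => //; rewrite -my; apply: mmin; left; left.
  - by exfalso; apply: (Nlt z y) => //; rewrite -mz; apply: mmin; left; right.
have lt_total x y : [\/ lt x y, x = y | lt y x].
  have [->|/eqP xy] := eqVneq x y; first by apply: Or32.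
  by case/orP: (Wtot x y) => ?; [apply: Or31|apply: Or33; split => //; exact/nesym].
have lt_wf : well_founded lt.
  move=> x; apply: contrapT => Nx.
  have [|m Nm mmin] := Wmin [set x | ~ Acc lt x]; first by exists x.
  by apply: Nm; constructor => y ym; apply: contrapT => /mmin /Nlt.
have [all_small|/existsNP[a0 Na0]] := pselect (forall x, small [set y | lt y x]).
  by exists lt.
(* Otherwise the least large segment has a copy of [R], whose order we take. *)
have [|a Na amin] := Wmin [set a | ~ small [set y | lt y a]]; first by exists a0.
have /existsNP[g /forallNP gsurj] := Na.
have ex r : exists y, lt y a /\ g y = r.
  apply: contrapT => N; apply: (gsurj r) => y ya gy; apply: N; by exists y.
have [phi phiP] := choice ex.
exists (fun x y => lt (phi x) (phi y)); split.
- move=> x; have := lt_wf (phi x); move e : (phi x) => u acc.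
  elim: acc x e => {}u _ IH x xu; constructor => y yx.
  by apply: (IH (phi y)) => //; rewrite -xu.
- by move=> x y z; exact: lt_trans.
- move=> x y; have [|e|] := lt_total (phi x) (phi y); [by apply: Or31| |by apply: Or33].
  by apply: Or32; rewrite -(phiP x).2 e (phiP y).2.
- move=> x; have : small [set y | lt y (phi x)].
    by apply: contrapT => /amin /Nlt; apply; exact: (phiP x).1.
  move=> /(small_image g); apply: small_sub => y yx.
  by exists (phi y) => //; exact: (phiP y).2.
Qed.

End Continuum.

(** * Transfinite recursion with choice *)

(** A choice function solves each stage from any total [g]. The recursion feeds it the values found
    so far, extended by [t0], and locality of [P] then allows this extension to be replaced by the
    final [p]. *)
Lemma wf_dependent_choice (I T : Type) (t0 : T) (lt : I -> I -> Prop)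
    (P : I -> (I -> T) -> T -> Prop) :
  well_founded lt ->
  (forall a g g' v, (forall b, lt b a -> g b = g' b) -> P a g v -> P a g' v) ->
  (forall a g, exists v, P a g v) ->
  exists p, forall a, P a p (p a).
Proof.
move=> wf Plocal Pex.
have [F FP] := choice (fun ag : I * (I -> T) => Pex ag.1 ag.2).
pose ext a (rec : forall b, lt b a -> T) b :=
  if pselect (lt b a) is left h then rec b h else t0.
pose p := Fix wf (fun=> T) (fun a rec => F (a, ext a rec)).
have pE a : p a = F (a, ext a (fun b _ => p b)).
  rewrite /p Fix_eq// => b f g fg; congr (F (b, ext b _)).
  by do 2!apply: functional_extensionality_dep => ?; exact: fg.
exists p => a; rewrite pE.
by apply: Plocal (FP (a, _)) => b ba; rewrite /ext /=; case: pselect.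
Qed.

(** * Coding continuous partial functions by sets of rational boxes *)

Section CodedFunctions.
Variable R : realType.
Implicit Types (x y z : R).

Definition box_code : countType := ((rat * rat) * (rat * rat))%type.

(* [((a, b), (c, d))] stands for the open box [ ]a, b[ x ]c, d[ ]. *)
Definition allowed_value (S : set box_code) x y :=
  forall k, S k -> ratr k.1.1 < x < ratr k.1.2 -> ratr k.2.1 < y < ratr k.2.2.

(** Uniqueness of the allowed value makes this a partial function for every [S], even one that comes
    from no continuous function, so arbitrary sets of codes can serve as tasks. *)
Definition coded_graph (S : set box_code) : set (R * R) :=
  [set p | allowed_value S p.1 p.2 /\
           forall z, allowed_value S p.1 z -> z = p.2].

Lemma coded_graph_functional S x y z :
  coded_graph S (x, y) -> coded_graph S (x, z) -> y = z.
Proof. by move=> [Sy _] [_ /(_ _ Sy)]. Qed.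

Lemma ratr_between x y : x < y -> exists2 q : rat, x < ratr q & ratr q < y.
Proof. by move=> /rat_in_itvoo[q]; rewrite in_itv => /andP[]; exists q. Qed.

(** Take for [S] all boxes that the graph respects. Then [f x] is allowed at [x], and continuity at
    [x] supplies a box that rules out any other value [z]. *)
Lemma pgraph_sub_coded_graph (D : set R) (f : R -> R) :
  {within D, continuous f} -> exists S, pgraph D f `<=` coded_graph S.
Proof.
move=> /subspace_continuousP fc.
pose S : set box_code := [set k | forall x, D x ->
  ratr k.1.1 < x < ratr k.1.2 -> ratr k.2.1 < f x < ratr k.2.2].
exists S => -[x _] [/= Dx ->]; split=> [k Sk|z Sz]; first exact: Sk.
apply: contrapT => /eqP zfx.
have zfx0 : 0 < `|z - f x| by rewrite normr_gt0 subr_eq0.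
(* The interval from [c] to [d] contains [f x] and stays within distance [|z - f x|] of it, so it
   misses [z]. *)
have [c c1 c2] : exists2 c : rat, f x - `|z - f x| < ratr c & ratr c < f x.
  by apply: ratr_between; lra.
have [d d1 d2] : exists2 d : rat, f x < ratr d & ratr d < f x + `|z - f x|.
  by apply: ratr_between; lra.
have /(fc x Dx) : nbhs (f x) [set y | ratr c < y < ratr d].
  have -> : [set y | ratr c < y < ratr d] = `]ratr c, ratr d[%classic :> set R.
    by apply/seteqP; split => y /=; rewrite in_itv.
  by apply: near_in_itvoo; rewrite in_itv /= c2 d1.
rewrite /fmap /within /= => /nbhs_ballP[e /= e0 he].
have [a a1 a2] : exists2 a : rat, x - e < ratr a & ratr a < x.
  by apply: ratr_between; lra.
have [b b1 b2] : exists2 b : rat, x < ratr b & ratr b < x + e.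
  by apply: ratr_between; lra.
have Sk : S ((a, b), (c, d)).
  move=> w Dw /= /andP[aw wb]; apply: he => //=.
  by rewrite /ball /= ltr_norml; apply/andP; split; lra.
have := Sz _ Sk; rewrite /= a2 b1 => /(_ isT) /andP[cz zd].
have [z0|z0] := ltP (z - f x) 0.
  by move: c1; rewrite ltr0_norm//; lra.
by move: d2; rewrite ger0_norm//; lra.
Qed.

End CodedFunctions.

(** * Plane geometry *)

Section Geometry.
Variable R : realType.
Implicit Types (d e f p q r : R * R).

(** For nonzero [d], the level sets of [dot d] are the lines with normal [d], and [cross d] is a
    coordinate along each of them. *)
Definition dot d p := d.1 * p.1 + d.2 * p.2.
Definition cross d p := d.1 * p.2 - d.2 * p.1.

Lemma pair_neq0 d : d != 0 -> d.1 != 0 \/ d.2 != 0.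
Proof.
case: d => a b /=; have [->|] := eqVneq a 0; last by left.
by have [->|] := eqVneq b 0; [rewrite eqxx|right].
Qed.

(** Either coordinate of [e] times [dot d f] is a combination of the two vanishing quantities, and
    [e] has a nonzero coordinate. *)
Lemma dot_eq0_cross d e f :
  e != 0 -> cross f e = 0 -> dot d e = 0 -> dot d f = 0.
Proof.
case: d e f => [d1 d2] [e1 e2] [f1 f2]; rewrite /cross /dot /= => /pair_neq0 /= e0 c de.
have h1 : (d1 * f1 + d2 * f2) * e1 = 0.
  have -> : (d1 * f1 + d2 * f2) * e1 =
    f1 * (d1 * e1 + d2 * e2) - d2 * (f1 * e2 - f2 * e1) by ring.
  by rewrite c de; ring.
have h2 : (d1 * f1 + d2 * f2) * e2 = 0.
  have -> : (d1 * f1 + d2 * f2) * e2 =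
    f2 * (d1 * e1 + d2 * e2) + d1 * (f1 * e2 - f2 * e1) by ring.
  by rewrite c de; ring.
move: h1 h2 => /eqP + /eqP; rewrite !mulf_eq0 => /orP[/eqP//|/eqP E1] /orP[/eqP//|/eqP E2].
by case: e0; rewrite ?E1 ?E2 eqxx.
Qed.

(** A quarter turn of [d] and [e] exchanges dot and cross products, which reduces this to the
    previous lemma. *)
Lemma cross_eq0_dot d e f :
  d != 0 -> dot d e = 0 -> dot d f = 0 -> cross e f = 0.
Proof.
case: d e f => [d1 d2] [e1 e2] [f1 f2] d0 de df.
have := @dot_eq0_cross (- e2, e1) (- d2, d1) (f1, f2).
rewrite /cross /dot /= in de df * => h.
have -> : e1 * f2 - e2 * f1 = - e2 * f1 + e1 * f2 by ring.
apply: h; last by rewrite -[RHS]de; ring.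
  by move: d0; apply: contra => /eqP[/eqP + /eqP]; rewrite oppr_eq0 => /eqP-> /eqP->.
by rewrite -[RHS]df; ring.
Qed.

Lemma dotB d p q : dot d (p - q) = dot d p - dot d q.
Proof. by case: p q => [p1 p2] [q1 q2]; rewrite /dot /=; ring. Qed.

Lemma dotC d p : dot d p = dot p d.
Proof. by rewrite /dot; ring. Qed.

(** Otherwise [p - q] would be a nonzero vector orthogonal to both [d] and [d'], forcing these to be
    parallel. *)
Lemma dot_inj2 d d' p q : cross d d' != 0 ->
  dot d p = dot d q -> dot d' p = dot d' q -> p = q.
Proof.
move=> /eqP dd' h h'; apply/eqP; rewrite -subr_eq0; apply/negPn/negP => pq.
by apply: dd'; apply: (cross_eq0_dot pq); rewrite dotC dotB ?h ?h' subrr.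
Qed.

(** Hence the lines that the rotation makes vertical are those with normal
    [(cos theta, - sin theta)], and [cross] gives the height on them. *)
Lemma rotation_dot_cross (theta : R) p : rotation theta p =
  (dot (cos theta, - sin theta) p, cross (cos theta, - sin theta) p).
Proof. by rewrite /rotation /dot /cross /=; congr pair; ring. Qed.

Lemma norm2_gt0 d : d != 0 -> 0 < dot d d.
Proof.
rewrite /dot -!expr2 lt_def addr_ge0 ?sqr_ge0// andbT paddr_eq0 ?sqr_ge0//.
by rewrite !sqrf_eq0 -xpair_eqE -surjective_pairing.
Qed.

Lemma dot_cross_inj d p q : d != 0 ->
  dot d p = dot d q -> cross d p = cross d q -> p = q.
Proof.
move=> /norm2_gt0 d0 h h'; apply: (@dot_inj2 d (- d.2, d.1)) => //.
- by move: d0; rewrite lt_def => /andP[+ _]; rewrite /dot /cross /= mulrN opprK.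
- by move: h'; rewrite /dot /cross /= => h'; rewrite !mulNr ![- _ + _]addrC.
Qed.

Lemma line_surj d (c t : R) : d != 0 -> exists p, dot d p = c /\ cross d p = t.
Proof.
move=> /norm2_gt0; case: d => a b; rewrite /dot /cross /= => n0.
have {}n0 : a * a + b * b != 0 by rewrite gt_eqF.
(* The solution of the linear system, whose determinant is [a * a + b * b]. *)
exists ((c * a - t * b) / (a * a + b * b), (c * b + t * a) / (a * a + b * b)).
by split => /=; field.
Qed.

Lemma line_not_small d (c : R) : d != 0 -> ~ small R [set p | dot d p = c].
Proof.
by move=> d0 /(_ (cross d))[t ht]; have [p [/ht]] := line_surj c t d0.
Qed.

End Geometry.

(** * The transfinite construction *)

Section Enumerations.
Variable R : realType.

(** The default [(1, 0)] for the zero vector makes every real code a genuine line or task. *)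
Let nz (d : R * R) : R * R := if d == 0 then (1, 0) else d.

Let nz_neq0 d : nz d != 0.
Proof.
rewrite /nz; case: ifPn => // _.
by apply/eqP => /(congr1 fst) /eqP; rewrite oner_eq0.
Qed.

Let nz_id d : d != 0 -> nz d = d.
Proof. by rewrite /nz => /negPf->. Qed.

Lemma line_enumeration : exists line : R -> (R * R) * R,
  (forall a, (line a).1 != 0) /\
  (forall (d : R * R) c, d != 0 -> exists a b, [/\ a <> b, line a = (d, c) & line b = (d, c)]).
Proof.
have [e eS] := surj_prod R.
exists (fun a => (nz (e (e (e a).1).1), (e (e a).1).2)); split=> [a|d c d0].
  exact: nz_neq0.
have [x ex] := eS d; have [y ey] := eS (x, c).
(* The spare coordinate, 0 or 1, lists each line at two distinct stages, as a stage adds at most one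
   point. *)
have [a ea] := eS (y, 0); have [b eb] := eS (y, 1).
exists a, b; rewrite ea eb /= ey /= ex nz_id//; split => // ab.
by move: ea; rewrite ab eb => -[/eqP]; rewrite oner_eq0.
Qed.

Lemma task_enumeration (K : countType) : exists task : R -> (R * R) * set K,
  (forall a, (task a).1 != 0) /\
  (forall (d : R * R) S, d != 0 -> exists a, task a = (d, S)).
Proof.
have [e eS] := surj_prod R; have [s sS] := surj_set_count R K.
exists (fun a => (nz (e (e a).1), s (e a).2)); split=> [a|d S d0].
  exact: nz_neq0.
have [x ex] := eS d; have [y sy] := sS S; have [a ea] := eS (x, y).
by exists a; rewrite ea /= ex sy nz_id.
Qed.

End Enumerations.

Section Construction.
Variables (R : realType) (lt : R -> R -> Prop).
Hypothesis lt_wf : well_founded lt.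
Hypothesis lt_trans : forall x y z, lt x y -> lt y z -> lt x z.
Hypothesis lt_total : forall x y, [\/ lt x y, x = y | lt y x].
Hypothesis lt_small : forall x, small R [set y | lt y x].
Variables (line : R -> (R * R) * R) (task : R -> (R * R) * set box_code).
Hypothesis line_neq0 : forall a, (line a).1 != 0.
Hypothesis task_neq0 : forall a, (task a).1 != 0.
Hypothesis lineP : forall (d : R * R) c, d != 0 ->
  exists a b, [/\ a <> b, line a = (d, c) & line b = (d, c)].
Hypothesis taskP : forall (d : R * R) S, d != 0 -> exists a, task a = (d, S).

Implicit Types (a b c : R) (d : R * R) (g : R -> R * R) (v : R * R).

Definition on_line a v := dot (line a).1 v = (line a).2.

Definition full a g := exists b c,
  [/\ lt b a, lt c a, g b <> g c, on_line a (g b) & on_line a (g c)].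

(** One pair of indices serves all clauses: [c] indexes a point in the second and a task in the last
    two. Lines are parallel when the [cross] of their normals vanishes. *)
Definition in_general_position a g v := forall b c, lt b a -> lt c a ->
  [/\ v <> g b,
      g b <> g c -> cross (g c - g b) (v - g b) <> 0,
      cross (task c).1 (line a).1 != 0 -> dot (task c).1 v <> dot (task c).1 (g b) &
      cross (task c).1 (line a).1 = 0 ->
        ~ coded_graph (task c).2 (dot (task c).1 v, cross (task c).1 v)].

(** On a full line the stage repeats an earlier point, which keeps [p] total; [fresh] later singles
    out first occurrences. *)
Definition stage a g v := on_line a v /\
  ((full a g /\ exists2 b, lt b a & v = g b) \/ in_general_position a g v).

Lemma stage_local a g g' v :
  (forall b, lt b a -> g b = g' b) -> stage a g v -> stage a g' v.
Proof.
move=> gg' [av st]; split => //; case: st => [[[b [c [ba ca bc bl cl]]] [b' b'a vb']]|gp].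
  left; split; last by exists b' => //; rewrite -gg'.
  by exists b, c; rewrite -!gg'.
by right => b c ba ca; have := gp b c ba ca; rewrite !gg'.
Qed.

(** If the line is not full, the four bad sets are ranges of partial functions on pairs of earlier
    stages, so their union is small, whereas a line is not. *)
Lemma stage_exists a g : exists v, stage a g v.
Proof.
have [[b [c [ba ca bc bl cl]]]|nfull] := pselect (full a g).
  by exists (g b); split => //; left; split; [exists b, c|exists b].
pose seg2 : set (R * R) := [set y | lt y a] `*` [set y | lt y a].
have seg2_small : small R seg2 by apply: small_square; exact: lt_small.
pose K1 (z : R * R) v := v = g z.1.
pose K2 (z : R * R) v := [/\ on_line a v, g z.1 <> g z.2 &
  cross (g z.2 - g z.1) (v - g z.1) = 0].
pose K3 (z : R * R) v := [/\ on_line a v, cross (task z.2).1 (line a).1 != 0 &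
  dot (task z.2).1 v = dot (task z.2).1 (g z.1)].
pose K4 (z : R * R) v := [/\ on_line a v, cross (task z.2).1 (line a).1 = 0 &
  coded_graph (task z.2).2 (dot (task z.2).1 v, cross (task z.2).1 v)].
pose bad (K : R * R -> R * R -> Prop) := [set v | exists2 z, seg2 z & K z v].
have s1 : small R (bad K1).
  by apply: (small_functional point) => // z v w _ -> ->.
have s2 : small R (bad K2).
  apply: (small_functional point) => // -[b c] v w [/= ba ca] [/= av bc cv] [aw _ cw].
  (* Two distinct bad points would identify the line through [g b] and [g c] with the line of stage
     [a], which would then be full. *)
  apply: contrapT => /eqP vw; apply: nfull; exists b, c.
  have gbc : g c - g b != 0 by rewrite subr_eq0; apply/eqP => /esym.
  have dbc : dot (line a).1 (g c - g b) = 0.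
    apply: (@dot_eq0_cross _ _ (v - w)); first by rewrite subr_eq0.
      have -> : v - w = (v - g b) - (w - g b) by rewrite opprB addrA subrK.
      by rewrite /cross in cv cw *; rewrite /=; lra.
    by rewrite dotB av aw subrr.
  have /eqP : dot (line a).1 (v - g b) = 0.
    apply: (dot_eq0_cross gbc) => //.
    by move: cv; rewrite /cross => cv; lra.
  rewrite dotB av subr_eq0 eq_sym => /eqP db.
  by split => //; move/eqP: dbc; rewrite dotB subr_eq0 db => /eqP.
have s3 : small R (bad K3).
  apply: (small_functional point) => // -[b c] v w _ [/= av ac cv] [aw _ cw].
  by apply: (dot_inj2 ac); rewrite ?cv ?cw// av aw.
have s4 : small R (bad K4).
  apply: (small_functional point) => // -[b c] v w _ [/= av ac cv] [aw _ cw].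
  (* The normals being parallel, [v] and [w] have the same abscissa for the task, and its graph
     allows one ordinate there. *)
  have e : dot (task c).1 v = dot (task c).1 w.
    apply/eqP; rewrite -subr_eq0 -dotB dotC; apply/eqP.
    apply: (dot_eq0_cross (line_neq0 a)) => //.
    by rewrite dotC dotB av aw subrr.
  apply: (dot_cross_inj (task_neq0 c) e).
  by rewrite e in cv; exact: coded_graph_functional cv cw.
have sU := small_setU (small_setU s1 s2) (small_setU s3 s4).
have [v av Nv] : exists2 v, on_line a v &
    ~ ((bad K1 `|` bad K2) `|` (bad K3 `|` bad K4)) v.
  apply: contrapT => N; apply: (@line_not_small _ _ (line a).2 (line_neq0 a)).
  by apply: small_sub sU => v av; apply: contrapT => Nv; apply: N; exists v.
exists v; split => //; right => b c ba ca; split.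
- by move=> vb; apply: Nv; left; left; exists (b, c).
- by move=> bc cv; apply: Nv; left; right; exists (b, c).
- by move=> ac cv; apply: Nv; right; left; exists (b, c).
- by move=> ac cv; apply: Nv; right; right; exists (b, c).
Qed.

(** * Properties of the constructed set *)

Variable p : R -> R * R.
Hypothesis pP : forall a, stage a p (p a).

Definition fresh a := forall b, lt b a -> p b <> p a.

Lemma exists_fresh a : exists2 b, fresh b & p b = p a.
Proof.
elim/(well_founded_ind lt_wf): a => a IH.
have [[b ba pb]|N] := pselect (exists2 b, lt b a & p b = p a).
  by have [c fc pc] := IH b ba; exists c => //; rewrite pc.
by exists a => // b ba pb; apply: N; exists b.
Qed.

Lemma fresh_general_position a : fresh a -> in_general_position a p (p a).
Proof. by move=> fa; case: (pP a) => _ [[_ [b /fa pb /esym]]|]. Qed.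

Lemma fresh_not_collinear a b c d t : d != 0 -> fresh a -> lt b a -> lt c a ->
  p b <> p c -> dot d (p a) = t -> dot d (p b) = t -> dot d (p c) = t -> False.
Proof.
move=> d0 fa ba ca bc da db dc.
have [_ /(_ bc) h _ _] := fresh_general_position fa ba ca; apply: h.
by apply: (cross_eq0_dot d0); rewrite dotB ?da ?db ?dc subrr.
Qed.

(** The line is listed at stages [a1] and [a2], the later of which either finds two points on it or
    adds a point other than [p a1]. A third point is impossible because the last of three collinear
    points violates general position. *)
Lemma two_points d t : d != 0 -> exists bc : R * R,
  [/\ fresh bc.1, fresh bc.2, lt bc.1 bc.2, dot d (p bc.1) = t /\ dot d (p bc.2) = t &
      forall a, dot d (p a) = t -> p a = p bc.1 \/ p a = p bc.2].
Proof.
move=> d0.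
have [b [c [fb fc bc db dc]]] : exists b c, [/\ fresh b, fresh c, p b <> p c,
    dot d (p b) = t & dot d (p c) = t].
  suff [b [c [bc db dc]]] : exists b c,
      [/\ p b <> p c, dot d (p b) = t & dot d (p c) = t].
    have [b' fb' pb'] := exists_fresh b; have [c' fc' pc'] := exists_fresh c.
    by exists b', c'; rewrite pb' pc'.
  have [a1 [a2 [ne l1 l2]]] := lineP t d0.
  wlog a12 : a1 a2 ne l1 l2 / lt a1 a2.
    by move=> W; have [|//|] := lt_total a1 a2; [exact: W|exact: W (nesym ne) l2 l1].
  have [l1a _] := pP a1; have [l2a st2] := pP a2.
  rewrite /on_line l1 /= in l1a; rewrite /on_line l2 /= in l2a.
  case: st2 => [[[b [c []]]]|gp].
    by rewrite /on_line l2 /= => _ _ bc db dc _; exists b, c.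
  by have [+ _ _ _] := gp _ _ a12 a12; exists a2, a1.
wlog lbc : b c fb fc bc db dc / lt b c.
  move=> W; have [h|e|h] := lt_total b c; first exact: (W b c).
    by rewrite e in bc.
  by apply: (W c b) => //; exact/nesym.
exists (b, c); split => //= a.
have [a' fa <-] := exists_fresh a => da.
apply: contrapT => /not_orP[ab ac].
have [h|e|h] := lt_total a' c.
- exact: (fresh_not_collinear d0 fc lbc h (nesym ab) dc db da).
- by rewrite e in ac.
- exact: (fresh_not_collinear d0 fa (lt_trans lbc h) h bc da db dc).
Qed.

Lemma Mazurkiewicz_range : Mazurkiewicz_set (range p).
Proof.
move=> L [a [b [t [ab ->]]]].
have [[c e] [_ fe ce [/= dc de] all2]] := two_points t (ab : (a, b) != 0).
suff -> : range p `&` [set q | a * q.1 + b * q.2 = t] = [set p c; p e].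
  apply/eq_cardSP; exists (p c); first by left.
  suff -> : [set p c; p e] `\ p c = [set p e] by exact: card_set1.
  apply/seteqP; split=> [q [[]//]|q ->]; split; first by right.
  by apply/nesym; exact: fe.
apply/seteqP; split=> [_ [[x _ <-] /all2]//|_ [->|->]]; split => //.
Qed.

Lemma rotation_SZ (theta : R) : exists f : R -> R,
  SZ_function f /\ pgraph setT f `<=` rotation theta @` range p.
Proof.
pose d : R * R := (cos theta, - sin theta).
have d0 : d != 0.
  apply/eqP => d0; have := cos2Dsin2 theta.
  have -> : cos theta = 0 by exact: (congr1 fst d0).
  have -> : sin theta = 0 by apply: oppr_inj; rewrite oppr0; exact: (congr1 snd d0).
  by rewrite expr0n addr0 => /eqP; rewrite eq_sym oner_eq0.
have [bc bcP] := choice (fun x => @two_points d x d0).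
have rotE x : rotation theta (p (bc x).2) = (x, cross d (p (bc x).2)).
  by rewrite rotation_dot_cross -/d; have [_ _ _ [_ ->]] := bcP x.
(* The height of the later of the two points on the line that the rotation sends to the vertical
   line at [x]. *)
exists (fun x => cross d (p (bc x).2)); split; last first.
  move=> [x _] [_ /= ->]; exists (p (bc x).2) => //; by exists (bc x).2.
move=> F [D [h [hc ->]]]; apply: small_card_lt.
have [S hS] := pgraph_sub_coded_graph hc.
have [a aS] := taskP S d0.
(* Stage [a] itself is included because general position concerns strictly earlier tasks only. *)
have seg_small : small R ([set y | lt y a] `|` [set a]).
  by apply: small_setU; [exact: lt_small|exact/finite_small/finite_set1].
apply: small_sub (small_image (fun c => rotation theta (p c)) seg_small).
move=> [x y] [[_ /= ->]] /hS Sx; exists (bc x).2; last exact: rotE.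
have [_ fc lbc [db dc] _] := bcP x.
have [ca|->|ac] := lt_total (bc x).2 a; [by left|by right|exfalso].
(* Past stage [a], the earlier point on the same line contradicts the third clause unless the line
   of the stage is parallel to it; in that case the fourth clause excludes the graph. *)
have [_ _ +] := fresh_general_position fc lbc ac; rewrite aS /= => h3 h4.
have [e|/h3] := eqVneq (cross d (line (bc x).2).1) 0; last by rewrite db dc.
by apply: (h4 e); rewrite dc.
Qed.

End Construction.

Theorem theorem3p2 (R : realType) :
  exists M : set (R * R), Mazurkiewicz_set M /\
    forall theta : R, exists f : R -> R,
      SZ_function f /\ pgraph setT f `<=` rotation theta @` M.
Proof.
have [lt [lt_wf lt_trans lt_total lt_small]] := well_order_small_segments R.
have [line [line_neq0 lineP]] := line_enumeration R.
have [task [task_neq0 taskP]] := task_enumeration R box_code.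
have [p pP] := wf_dependent_choice point lt_wf (@stage_local R lt line task)
  (stage_exists lt_small line_neq0 task_neq0).
exists (range p); split; first exact: (Mazurkiewicz_range lt_wf lt_trans lt_total lineP pP).
by move=> theta; exact: (rotation_SZ lt_wf lt_trans lt_total lt_small lineP taskP pP).
Qed.
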